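(* Let $d\ge1$ be an integer, let $0<\alpha\le2$, and let $(a_z)_{z\in\mathbb{Z}^d\setminus\{0\}}$ be real coefficients such that $a_z\|z\|^{d+\alpha}\to1$ as $\|z\|\to\infty$. Let \[ F(\theta)=\sum_{z\in\mathbb{Z}^d\setminus\{0\}}a_z(1-\cos\langle z,\theta\rangle),\qquad F_d(\theta)=\sum_{z\in\mathbb{Z}^d\setminus\{0\}}\frac{1}{\|z\|^{d+\alpha}}(1-\cos\langle z,\theta\rangle),\qquad\theta\in\mathbb{R}^d. \] Then $F(\theta)\simeq F_d(\theta)$ as $\theta\to0$.
   Context: $\langle\cdot,\cdot\rangle$ is the standard inner product and $\|x\|=\max_i|x_i|$ is the max-norm on $\mathbb{R}^d$. $h_1(\theta)\simeq h_2(\theta)$ as $\theta\to\theta_0$ means $h_1(\theta)/h_2(\theta)\to1$ as $\theta\to\theta_0$. *)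

(* Defs.v *)
From mathcomp Require Import all_boot all_order all_algebra.
From mathcomp Require Import all_classical all_reals all_analysis.

Set Implicit Arguments.
Unset Strict Implicit.
Unset Printing Implicit Defensive.

Import Order.TTheory GRing.Theory Num.Theory.
Import numFieldNormedType.Exports.

Local Open Scope classical_set_scope.
Local Open Scope ring_scope.

Section Defs.
Variable R : realType.

Definition inner (d : nat) (x y : 'rV[R]_d) : R := \sum_(i < d) x 0 i * y 0 i.

(* Points of Z^d are row vectors of integers.  The norm `|_| on 'rV[R]_d is
   the library's mx_norm, that is, the max-norm. *)
Definition emb (d : nat) (z : 'rV[int]_d) : 'rV[R]_d := map_mx intr z.

(* The filter ||z|| -> oo on Z^d. *)
Definition lattice_infty (d : nat) : set_system 'rV[int]_d :=
  filter_from [set: R] (fun M => [set z | M < `|emb z|]).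

(* Unordered sum of an absolutely summable real family.  If both the positive
   and the negative part have finite sums this is their difference; otherwise
   the value is meaningless. *)
Definition usum (T : choiceType) (D : set T) (f : T -> R) : R :=
  fine (\esum_(x in D) (EFin \o f)^\+ x - \esum_(x in D) (EFin \o f)^\- x)%E.

(* \sum_(z in Z^d \ {0}) a_z (1 - cos <z, theta>); the value of a at 0 is
   not used. *)
Definition cos_sum (d : nat) (a : 'rV[int]_d -> R) (theta : 'rV[R]_d) : R :=
  usum [set z : 'rV[int]_d | z != 0]
    (fun z => a z * (1 - cos (inner (emb z) theta))).

(* h1 ~ h2 as x -> x0 (x <> x0).  Since division by 0 gives 0, convergence of
   the quotient to 1 forces h2 to be nonzero on a punctured neighbourhood. *)
Definition asymp_equiv (T : topologicalType) (h1 h2 : T -> R) (x0 : T) : Prop :=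
  h1 x / h2 x @[x --> x0^'] --> (1 : R).

End Defs.

Arguments lattice_infty : clear implicits.

(* Main.v *)
Require Import Defs.
From mathcomp Require Import all_boot all_order all_algebra.
From mathcomp Require Import all_classical all_reals all_analysis.
From mathcomp Require Import zify ring lra.

Import Order.TTheory GRing.Theory Num.Theory.
Import numFieldNormedType.Exports.

Local Open Scope classical_set_scope.
Local Open Scope ring_scope.

(** Write [b z = 1 / |z| ^ (d + alpha)] for the model coefficients, [F] and [Fd]
    for the two sums.  Given [e > 0], the hypothesis makes [|a z - b z|] at most
    [e * b z] outside a finite ball, and the finitely many remaining terms of
    [F - Fd] are each [O(|theta| ^ 2)] because [1 - cos x <= x ^ 2 / 2].  Hence
    [|F - Fd| <= e * Fd + C * |theta| ^ 2] with [C] depending on [e] but not on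
    [theta] ([cos_sum_near]).

    It remains to see that the quadratic error is negligible, that is, that
    [Fd theta / |theta| ^ 2] tends to infinity ([cos_sum_decay_dominates_sqr]);
    this is where [alpha <= 2] enters.  Split the lattice dyadically.  At scale
    [2 ^ m] there are [2 ^ (m * d)] lattice points whose coordinates have the
    signs of those of [theta] and which are long in the direction of a largest
    coordinate of [theta] (an [aligned_block]).  No cancellation occurs in
    [<z, theta>] for them, so [<z, theta> >= 2 ^ m * |theta|], and as long as
    [<z, theta> <= 1] the term of [z] in [Fd] is at least a constant times
    [2 ^ (- m * (d + 2)) * 2 ^ (2 * m) * |theta| ^ 2].  Each block therefore
    contributes a fixed multiple of [|theta| ^ 2], whatever its scale, and the
    number of usable scales, about [log_2 (1 / |theta|)], grows without bound.

    The same dyadic decomposition shows that the weights [b] are summable: the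
    shell at scale [2 ^ m] contributes at most a constant times
    [2 ^ (- m * alpha)] ([summable_decay]).  This makes all the unordered sums
    genuine, so that they can be compared term by term ([usum_le_add],
    [usum_lin]). *)

(** * Quadratic bounds for the cosine *)

Lemma ler_abs_sin {R : realType} (x : R) : `|sin x| <= `|x|.
Proof.
wlog x0 : x / 0 <= x => [H|].
  have [/H//|x0] := leP 0 x.
  by rewrite -normrN -sinN -(normrN x); apply: H; rewrite oppr_ge0 ltW.
have [|c _] := @MVT_segment R sin cos 0 x x0.
- by apply: continuous_subspaceT => y; exact: continuous_sin.
by rewrite sin0 !subr0 => ->; rewrite normrM ler_piMl// cos_max.
Qed.

(** The half-angle formula turns both bounds on [1 - cos] into bounds on [sin]. *)
Lemma oneB_cosE {R : realType} (x : R) : 1 - cos x = 2 * sin (x / 2) ^+ 2.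
Proof.
have {1}-> : x = (x / 2) *+ 2 by rewrite -mulr_natr divfK// pnatr_eq0.
by rewrite cos_mulr2n sin2cos2; lra.
Qed.

Lemma oneB_cos_ge0 {R : realType} (x : R) : 0 <= 1 - cos x.
Proof. by rewrite subr_ge0 cos_le1. Qed.

Lemma oneB_cos_le {R : realType} (x : R) : 1 - cos x <= x ^+ 2 / 2.
Proof.
rewrite oneB_cosE -(real_normK (num_real (sin _))).
have : `|sin (x / 2)| ^+ 2 <= `|x / 2| ^+ 2.
  by rewrite lerXn2r ?nnegrE// ler_abs_sin.
rewrite (real_normK (num_real (x / 2))) expr_div_n; lra.
Qed.

(** By the mean value theorem, since [cos] is at least [1/2] on [[0, 1]]. *)
Lemma ler_sin_half {R : realType} (x : R) : 0 <= x <= 1 -> x / 2 <= sin x.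
Proof.
move=> /andP[x0 x1].
have [|c] := @MVT_segment R sin cos 0 x x0.
- by apply: continuous_subspaceT => y; exact: continuous_sin.
rewrite in_itv/= => /andP[c0 cx]; rewrite sin0 !subr0 => ->.
have := oneB_cos_le c.
have : c ^+ 2 <= 1 by rewrite expr_le1//; exact: le_trans x1.
move=> c1 cosc; rewrite mulrC ler_wpM2r//; lra.
Qed.

Lemma oneB_cos_ge {R : realType} (x : R) : `|x| <= 1 -> x ^+ 2 / 8 <= 1 - cos x.
Proof.
rewrite -cos_norm -(real_normK (num_real x)); move: (normr_ge0 x).
move: `|x| => {}x x0 x1; rewrite oneB_cosE.
have : x / 2 / 2 <= sin (x / 2) by apply: ler_sin_half; lra.
move=> h; have : (x / 2 / 2) ^+ 2 <= sin (x / 2) ^+ 2.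
  by rewrite lerXn2r ?nnegrE//; lra.
rewrite !expr_div_n; lra.
Qed.

(** * Sums over sets *)

Lemma esum_range_cst {R : realType} {I : finType} {T : choiceType}
    (e : I -> T) (c : R) : injective e -> 0 <= c ->
  (\esum_(z in range e) c%:E = (#|I|%:R * c)%:E)%E.
Proof.
move=> einj c0.
rewrite (@esum_image R I T setT e (fun=> c%:E)); last by move=> x y _ _ /einj.
rewrite esum_fset/=; [|exact: finite_finset|by move=> i _; rewrite lee_fin].
rewrite (@fsbigE _ _ _ _ _ (enum I))/= ?enum_uniq//; last first.
  by move=> i _; rewrite mem_enum.
rewrite (eq_bigl xpredT)/=; last by move=> i; rewrite in_setT.
by rewrite sumEFin big_enum/= sumr_const mulr_natl.
Qed.

Lemma subset_esum {R : realType} {T : choiceType} (A B : set T)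
    (f : T -> \bar R) : (forall x, 0 <= f x)%E -> A `<=` B ->
  (\esum_(x in A) f x <= \esum_(x in B) f x)%E.
Proof.
move=> f0 AB; rewrite (esumID A B)// (setIidr AB).
by rewrite leeDl// esum_ge0.
Qed.

Lemma ge0_esumZl {R : realType} {T : choiceType} (D : set T) (r : R)
    (f : T -> \bar R) : 0 <= r -> (forall x, D x -> 0 <= f x)%E ->
  (\esum_(x in D) (r%:E * f x) = r%:E * \esum_(x in D) f x)%E.
Proof.
move=> r0 f0.
have sup_ne0 : [set (\sum_(x \in A) f x)%E | A in fsets D] != set0.
  apply/set0P; exists (\sum_(x \in set0) f x)%E; exists set0 => //.
  exact: fsets_set0.
rewrite /esum -ereal_supZl//.
have sumZ A : finite_set A -> A `<=` D ->
    (\sum_(x \in A) (r%:E * f x) = r%:E * \sum_(x \in A) f x)%E.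
  move=> finA AD; rewrite !fsbig_finite// big_seq [in RHS]big_seq.
  by rewrite ge0_sume_distrr// => i; rewrite in_fset_set// inE => /AD/f0.
congr ereal_sup; apply/seteqP; split => [_ [A [finA AD] <-]|].
  by exists (\sum_(x \in A) f x)%E; [exists A|rewrite sumZ].
by move=> _ [_ [A [finA AD] <-] <-]; exists A; rewrite ?sumZ.
Qed.

Lemma summable_le {R : realType} {T : choiceType} (D : set T)
    (f g : T -> \bar R) : summable D g ->
  (forall x, D x -> `|f x| <= `|g x|)%E -> summable D f.
Proof. by move=> sg fg; apply: le_lt_trans sg; exact: le_esum. Qed.

Lemma EFin_usum {R : realType} {T : choiceType} (D : set T) (f : T -> R) :
  summable D (EFin \o f) -> (forall x, D x -> 0 <= f x) ->
  (usum D f)%:E = (\esum_(x in D) (f x)%:E)%E.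
Proof.
move=> sf f0.
have fE : ((\esum_(x in D) (EFin \o f)^\+ x) = \esum_(x in D) (f x)%:E)%E.
  by apply: eq_esum => x Dx; rewrite funeposE max_l// lee_fin f0.
have fN : ((\esum_(x in D) (EFin \o f)^\- x) = 0)%E.
  apply: esum1 => x Dx; rewrite funenegE max_r//=; have := f0 x Dx; rewrite lee_fin.
  by rewrite oppr_le0.
rewrite /usum fE fN sube0 fineK//.
move: sf; rewrite summableE; congr (_ \is a fin_num).
by apply: eq_esum => x Dx /=; rewrite ger0_norm// f0.
Qed.

Lemma esum_part_fin_num {R : realType} {T : choiceType} (D : set T)
    (f : T -> \bar R) : summable D f ->
  (\esum_(x in D) f^\+ x \is a fin_num)%E /\
  (\esum_(x in D) f^\- x \is a fin_num)%E.
Proof.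
move=> sf; split.
  have := summable_funepos sf; rewrite summableE; congr (_ \is a fin_num).
  by apply: eq_esum => x _; rewrite gee0_abs.
have := summable_funeneg sf; rewrite summableE; congr (_ \is a fin_num).
by apply: eq_esum => x _; rewrite gee0_abs.
Qed.

(** Moving the negative parts to the other side turns the claim into an
    inequality between sums of nonnegative terms, [f^+ + g^- <= g^+ + f^- + h],
    which holds term by term; finiteness of the four sums is what allows them to
    be moved. *)
Lemma usum_le_add {R : realType} {T : choiceType} (D : set T) (f g h : T -> R) :
  summable D (EFin \o f) -> summable D (EFin \o g) -> summable D (EFin \o h) ->
  (forall x, D x -> 0 <= h x) -> (forall x, D x -> f x <= g x + h x) ->
  usum D f <= usum D g + usum D h.
Proof.
move=> sf sg sh h0 fgh.
have [fP fN] := esum_part_fin_num _ _ sf.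
have [gP gN] := esum_part_fin_num _ _ sg.
have ge0 x : D x -> (0 <= (h x)%:E)%E by move=> Dx; rewrite lee_fin h0.
have : (\esum_(x in D) (EFin \o f)^\+ x + \esum_(x in D) (EFin \o g)^\- x <=
    \esum_(x in D) (EFin \o g)^\+ x + \esum_(x in D) (EFin \o f)^\- x +
    \esum_(x in D) (h x)%:E)%E.
  rewrite -!esumD// => [|x Dx]; last by rewrite adde_ge0.
  apply: le_esum => x Dx; rewrite !funeposE !funenegE/= -!EFin_max lee_fin.
  have := fgh x Dx; have := h0 x Dx.
  by case: (lerP (f x) 0); case: (lerP (- f x) 0);
     case: (lerP (g x) 0); case: (lerP (- g x) 0); lra.
rewrite -(EFin_usum _ _ sh h0) -(fineK fP) -(fineK fN) -(fineK gP) -(fineK gN).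
rewrite -!EFinD lee_fin => key.
rewrite {1 2}/usum !fineB//; lra.
Qed.

Lemma usum_lin {R : realType} {T : choiceType} (D : set T) (f g : T -> R) (r s : R) :
  summable D (EFin \o f) -> summable D (EFin \o g) ->
  (forall x, D x -> 0 <= f x) -> (forall x, D x -> 0 <= g x) ->
  0 <= r -> 0 <= s ->
  summable D (EFin \o (fun x => r * f x + s * g x)) /\
  usum D (fun x => r * f x + s * g x) = r * usum D f + s * usum D g.
Proof.
move=> sf sg f0 g0 r0 s0.
have h0 x : D x -> 0 <= r * f x + s * g x.
  by move=> Dx; rewrite addr_ge0// mulr_ge0// ?f0 ?g0.
have sumE : (\esum_(x in D) (r * f x + s * g x)%:E =
    (r * usum D f + s * usum D g)%:E)%E.
  rewrite EFinD !EFinM !EFin_usum// -!ge0_esumZl//.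
  by rewrite -esumD// => x Dx; rewrite -EFinM lee_fin mulr_ge0// ?f0 ?g0.
have sh : summable D (EFin \o (fun x => r * f x + s * g x)).
  rewrite summableE (_ : esum _ _ = \esum_(x in D) (r * f x + s * g x)%:E)%E.
    by rewrite sumE.
  by apply: eq_esum => x Dx /=; rewrite ger0_norm// h0.
by split=> //; apply: EFin_inj; rewrite EFin_usum.
Qed.

(** * The max-norm on the lattice, and cubes of lattice points *)

Lemma ler_coord_norm {R : realType} {d : nat} (x : 'rV[R]_d) (j : 'I_d) :
  `|x 0 j| <= `|x|.
Proof.
rewrite -[leRHS]/(mx_norm x) mx_normrE.
exact: (@le_bigmax _ _ _ 0 (fun ij => `|x ij.1 ij.2|) (0, j)).
Qed.

Lemma norm_row_le {R : realType} {d : nat} (x : 'rV[R]_d) (c : R) :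
  0 <= c -> (forall j, `|x 0 j| <= c) -> `|x| <= c.
Proof.
move=> c0 xc; rewrite -[leLHS]/(mx_norm x) mx_normrE; apply/bigmax_leP; split=> //.
by move=> [i j] _ /=; rewrite ord1.
Qed.

Lemma norm_row_attained {R : realType} {d : nat} (x : 'rV[R]_d) :
  x != 0 -> exists j, `|x| = `|x 0 j|.
Proof.
rewrite -normr_eq0 => /mx_norm_neq0 [[i j] xj]; exists j.
by rewrite [LHS]xj/= ord1.
Qed.

Lemma emb_eq0 {R : realType} {d : nat} (z : 'rV[int]_d) :
  (emb R z == 0) = (z == 0).
Proof.
apply/eqP/eqP => [/rowP h|->]; last by apply/rowP => j; rewrite !mxE.
by apply/rowP => j; have := h j; rewrite !mxE => /eqP; rewrite intr_eq0 => /eqP.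
Qed.

Lemma norm_emb_nat {R : realType} {d : nat} (z : 'rV[int]_d) : z != 0 ->
  exists2 n : nat, (0 < n)%N & `|emb R z| = n%:R.
Proof.
rewrite -(@emb_eq0 R) => z0; have [j zj] := norm_row_attained _ z0.
exists (absz (z 0 j)).
  by rewrite absz_gt0 -(intr_eq0 R); move: z0; rewrite -normr_eq0 zj normr_eq0 !mxE.
by rewrite zj !mxE -intr_norm -abszE.
Qed.

Lemma norm_emb_ge1 {R : realType} {d : nat} (z : 'rV[int]_d) : z != 0 ->
  1 <= `|emb R z|.
Proof. by move=> /(@norm_emb_nat R)[n n0 ->]; rewrite ler1n. Qed.

(** Cubes are parametrised by finite functions so that they can be counted; the
    factors [s j], always [1] or [-1] below, let a cube extend from its corner
    [o] into any orthant. *)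
Definition cube_pt {d : nat} (o s : 'I_d -> int) (K : nat)
    (k : {ffun 'I_d -> 'I_K}) : 'rV[int]_d :=
  \row_j (o j + s j * (k j : nat)%:Z).

Lemma cube_pt_inj {d : nat} (o s : 'I_d -> int) (K : nat) :
  (forall j, s j != 0) -> injective (@cube_pt d o s K).
Proof.
move=> s0 k l /rowP kl; apply/ffunP => j; have := kl j; rewrite !mxE.
by move=> /addrI /(mulfI (s0 j)) [] /val_inj.
Qed.

Lemma esum_cube {R : realType} {d : nat} (o s : 'I_d -> int) (K : nat) (c : R) :
  (forall j, s j != 0) -> 0 <= c ->
  (\esum_(z in range (@cube_pt d o s K)) c%:E = (K%:R ^+ d * c)%:E)%E.
Proof.
move=> s0 c0; rewrite esum_range_cst//; last exact: cube_pt_inj.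
by rewrite card_ffun !card_ord natrX.
Qed.

Lemma ball_sub_cube {R : realType} {d : nat} (K : nat) :
  [set z : 'rV[int]_d | `|emb R z| < K%:R] `<=`
  range (@cube_pt d (fun=> - K%:Z) (fun=> 1) K.*2).
Proof.
move=> z /= zK.
have zjK j : (`|z 0 j| < K%:Z)%R.
  rewrite -(ltr_int R) intr_norm; apply: le_lt_trans zK.
  by have := ler_coord_norm (emb R z) j; rewrite !mxE.
have zj j : (absz (z 0%R j + K%:Z)%R < K.*2)%N by have := zjK j; lia.
exists [ffun j => Ordinal (zj j)] => //.
by apply/rowP => j; rewrite !mxE ffunE/=; have := zjK j; lia.
Qed.

(** * Summability of the power weights *)

Definition decay {R : realType} {d : nat} (s : R) (z : 'rV[int]_d) : R :=
  1 / `|emb R z| `^ s.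

Lemma decay_ge0 {R : realType} {d : nat} (s : R) (z : 'rV[int]_d) :
  0 <= decay s z.
Proof. by rewrite divr_ge0// powR_ge0. Qed.

Lemma decay_gt0 {R : realType} {d : nat} (s : R) (z : 'rV[int]_d) :
  z != 0 -> 0 < decay s z.
Proof.
by move=> z0; rewrite divr_gt0// powR_gt0// (lt_le_trans ltr01)// norm_emb_ge1.
Qed.

Definition dyadic_shell (R : realType) (d m : nat) : set 'rV[int]_d :=
  [set z | 2 ^+ m <= `|emb R z| < 2 ^+ m.+1].

Lemma trivIset_dyadic_shell (R : realType) (d : nat) :
  trivIset [set: nat] (dyadic_shell R d).
Proof.
suff lt_false m n z : (m < n)%N -> dyadic_shell R d m z ->
    dyadic_shell R d n z -> False.
  move=> m n _ _ [z [zm zn]].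
  by case: (ltngtP m n) => // [mn|nm];
    [case: (lt_false m n z)|case: (lt_false n m z)].
move=> mn /andP[_ zm] /andP[zn _].
have : (2 : R) ^+ m.+1 <= 2 ^+ n by rewrite ler_weXn2l// ler1n.
by move=> /(lt_le_trans zm) /(le_lt_trans zn); rewrite ltxx.
Qed.

Lemma dyadic_shell_cover (R : realType) (d : nat) :
  [set z : 'rV[int]_d | z != 0] `<=` \bigcup_m dyadic_shell R d m.
Proof.
move=> z /(@norm_emb_nat R)[n n0 zn]; exists (trunc_log 2 n) => //.
rewrite /dyadic_shell/= zn -!natrX ler_nat ltr_nat trunc_logP//=.
exact: trunc_log_ltn.
Qed.

Lemma powR_exprn {R : realType} (x s : R) (m : nat) : 0 <= x ->
  (x ^+ m) `^ s = (x `^ s) ^+ m.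
Proof.
move=> x0; rewrite -(powR_mulrn _ x0) -(powR_mulrn _ (powR_ge0 x s)).
exact: powRAC.
Qed.

(** The shell lies in a cube with [(4 * 2 ^ m) ^ d] points, and each of its
    weights is at most [2 ^ (- m * s)]. *)
Lemma esum_dyadic_shell_le {R : realType} {d : nat} (s : R) (m : nat) : 0 <= s ->
  (\esum_(z in dyadic_shell R d m) (decay s z)%:E <=
   (4 ^+ d * (2 ^+ d / 2 `^ s) ^+ m)%:E)%E.
Proof.
move=> s0; set c := ((2 : R) `^ s)^-1 ^+ m.
have c0 : 0 <= c by rewrite exprn_ge0// invr_ge0 powR_ge0.
apply: (@le_trans _ _ (\esum_(z in dyadic_shell R d m) c%:E)%E).
  apply: le_esum => z /andP[zm _].
  rewrite lee_fin /decay /c exprVn div1r lef_pV2 ?posrE ?exprn_gt0 ?powR_gt0//.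
    by rewrite -powR_exprn// ge0_ler_powR// nnegrE// exprn_ge0.
  by apply: lt_le_trans zm; rewrite exprn_gt0.
pose B : set 'rV[int]_d :=
  range (@cube_pt d (fun=> - (2 ^ m.+1)%N%:Z) (fun=> 1) (2 ^ m.+1).*2).
apply: (@le_trans _ _ (\esum_(z in B) c%:E)%E).
  apply: subset_esum => [z|z /andP[_ zm]]; first by rewrite lee_fin.
  by apply: (@ball_sub_cube R); rewrite /= natrX.
rewrite esum_cube// lee_fin -mul2n -expnS natrX /c [(_ / _) ^+ m]exprMn mulrA.
have -> // : (2 ^+ m.+2) ^+ d = 4 ^+ d * (2 ^+ d) ^+ m :> R.
have -> : 4 = 2 ^+ 2 :> R by ring.
by rewrite -!exprM -exprD; congr (_ ^+ _); lia.
Qed.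

(** The shell bounds form a geometric series of ratio [2 ^ (d - s) < 1]. *)
Lemma summable_decay {R : realType} {d : nat} (s : R) : d%:R < s ->
  summable [set z : 'rV[int]_d | z != 0] (EFin \o decay s).
Proof.
move=> ds; have s0 : 0 <= s by apply: le_trans (ltW ds); rewrite ler0n.
set q : R := 2 ^+ d / 2 `^ s.
have q0 : 0 < q by rewrite divr_gt0 ?exprn_gt0 ?powR_gt0.
have q1 : `|q| < 1.
  rewrite gtr0_norm// ltr_pdivrMr ?powR_gt0// mul1r -powR_mulrn//.
  by rewrite /powR pnatr_eq0/= ltr_expR ltr_pM2r// ln_gt0// ltr1n.
have f0 (z : 'rV[int]_d) : (0 <= (decay s z)%:E)%E.
  by rewrite lee_fin decay_ge0.
pose D : set 'rV[int]_d := [set z | z != 0]; rewrite /summable -/D.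
apply: (@le_lt_trans _ _ (4 ^+ d * (1 - q)^-1)%:E); last exact: ltry.
apply: (@le_trans _ _
    (\esum_(z in \bigcup_m dyadic_shell R d m) (decay s z)%:E)%E).
  have -> : (\esum_(z in D) `|(decay s z)%:E| =
      \esum_(z in D) (decay s z)%:E)%E.
    by apply: eq_esum => z _; exact: gee0_abs.
  apply: subset_esum => //; exact: dyadic_shell_cover.
rewrite nneseries_sum_bigcup//; last exact: trivIset_dyadic_shell.
apply: lime_le; first by apply: is_cvg_nneseries => n _ _; exact: esum_ge0.
apply: nearW => n.
apply: (@le_trans _ _ (\sum_(0 <= m < n) (4 ^+ d * q ^+ m)%:E)%E).
  by apply: lee_sum => m _; exact: esum_dyadic_shell_le.
rewrite sumEFin lee_fin.
by apply: geometric_le_lim; rewrite // exprn_ge0.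
Qed.

(** * A divergent lower bound for the model sum *)

Lemma inner_le {R : realType} {d : nat} (x y : 'rV[R]_d) :
  `|inner x y| <= d%:R * (`|x| * `|y|).
Proof.
rewrite /inner; apply: le_trans (ler_norm_sum _ _ _) _.
apply: (@le_trans _ _ (\sum_(i < d) `|x| * `|y|)).
  by apply: ler_sum => i _; rewrite normrM ler_pM// ler_coord_norm.
by rewrite sumr_const card_ord mulr_natl.
Qed.

(** Allowing an exponent [t >= s] costs nothing because lattice points have
    norm at least [1]; it replaces [d + alpha] by the integer [d + 2]. *)
Lemma ler_decay {R : realType} {d : nat} (s r t : R) (z : 'rV[int]_d) :
  0 <= s <= t -> z != 0 -> `|emb R z| <= r -> 1 / r `^ t <= decay s z.
Proof.
move=> /andP[s0 st] z0 zr; have z1 := @norm_emb_ge1 R _ _ z0.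
have r1 : 1 <= r by apply: le_trans zr.
rewrite /decay !div1r lef_pV2 ?posrE ?powR_gt0//; try lra.
apply: (@le_trans _ _ (r `^ s)); last exact: ler_powR.
by rewrite ge0_ler_powR// nnegrE; lra.
Qed.

(** The sign of a coordinate, with value [1] at [0] so that it is never zero. *)
Definition orient {R : realType} {d : nat} (theta : 'rV[R]_d) (j : 'I_d) : int :=
  if 0 <= theta 0 j then 1 else -1.

Lemma orient_mul {R : realType} {d : nat} (theta : 'rV[R]_d) (j : 'I_d) :
  (orient theta j)%:~R * theta 0 j = `|theta 0 j|.
Proof.
rewrite /orient; case: ifPn => h; first by rewrite mul1r ger0_norm.
by rewrite mulrNz mulN1r ltr0_norm// ltNge.
Qed.

Lemma orient_neq0 {R : realType} {d : nat} (theta : 'rV[R]_d) (j : 'I_d) :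
  orient theta j != 0.
Proof. by rewrite /orient; case: ifP. Qed.

(** Only the [i]-th coordinate is shifted, to absolute values in
    [[2 ^ m, 2 ^ (m + 1))]: this makes blocks of different scales disjoint and
    makes [z] long in the direction [i], while the other coordinates may be
    small as long as they do not oppose [theta]. *)
Definition aligned_block {R : realType} {d : nat} (theta : 'rV[R]_d) (i : 'I_d)
    (m : nat) : set 'rV[int]_d :=
  range (@cube_pt d (fun j => orient theta j * ((j == i) * 2 ^ m)%N%:Z)
                    (orient theta) (2 ^ m)).

Lemma aligned_blockP {R : realType} {d : nat} (theta : 'rV[R]_d) (i : 'I_d)
    (m : nat) (z : 'rV[int]_d) : aligned_block theta i m z ->
  exists n : 'I_d -> nat, [/\ forall j, z 0 j = orient theta j * (n j)%:Z,
    forall j, (n j < 2 ^ m.+1)%N & (2 ^ m <= n i)%N].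
Proof.
move=> [k _ <-]; exists (fun j => ((j == i) * 2 ^ m + k j)%N); split.
- by move=> j; rewrite mxE PoszD mulrDr.
- by move=> j; have := ltn_ord (k j); rewrite expnS; case: (j == i); lia.
- by rewrite eqxx mul1n leq_addr.
Qed.

Lemma aligned_block_coord {R : realType} {d : nat} (theta : 'rV[R]_d) (i : 'I_d)
    (m : nat) (z : 'rV[int]_d) : aligned_block theta i m z ->
  (2 ^ m <= absz (z 0%R i) < 2 ^ m.+1)%N.
Proof.
move=> /aligned_blockP[n [zn nlt ni]]; rewrite zn abszM.
have -> : absz (orient theta i) = 1%N by rewrite /orient; case: ifP.
by rewrite mul1n absz_nat ni nlt.
Qed.

Lemma trivIset_aligned_block {R : realType} {d : nat} (theta : 'rV[R]_d)
    (i : 'I_d) : trivIset [set: nat] (aligned_block theta i).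
Proof.
move=> m n _ _ [z [/aligned_block_coord/andP[zm zm'] /aligned_block_coord/andP[zn zn']]].
have := leq_ltn_trans zm zn'; have := leq_ltn_trans zn zm'.
rewrite !ltn_exp2l//; lia.
Qed.

Lemma aligned_block_neq0 {R : realType} {d : nat} (theta : 'rV[R]_d) (i : 'I_d)
    (m : nat) (z : 'rV[int]_d) : aligned_block theta i m z -> z != 0.
Proof.
move=> /aligned_block_coord/andP[zm _]; apply: contraTneq zm => ->.
by rewrite mxE absz0 leqn0 expn_eq0.
Qed.

Lemma aligned_block_norm {R : realType} {d : nat} (theta : 'rV[R]_d) (i : 'I_d)
    (m : nat) (z : 'rV[int]_d) : aligned_block theta i m z ->
  `|emb R z| <= 2 ^+ m.+1.
Proof.
move=> /aligned_blockP[n [zn nlt _]]; apply: norm_row_le; first exact: exprn_ge0.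
move=> j; rewrite mxE -intr_norm zn normrM.
have -> : `|orient theta j| = 1 by rewrite /orient; case: ifP.
by rewrite mul1r ger0_norm// -pmulrn -natrX ler_nat ltnW.
Qed.

(** All the products [z_j * theta_j] are nonnegative, so the [i]-th one alone
    bounds the inner product from below. *)
Lemma aligned_block_inner {R : realType} {d : nat} (theta : 'rV[R]_d) (i : 'I_d)
    (m : nat) (z : 'rV[int]_d) : aligned_block theta i m z ->
  2 ^+ m * `|theta 0 i| <= inner (emb R z) theta.
Proof.
move=> /aligned_blockP[n [zn _ ni]].
have -> : inner (emb R z) theta = \sum_(j < d) (n j)%:R * `|theta 0 j|.
  apply: eq_bigr => j _; rewrite mxE zn intrM -orient_mul mulrA.
  by rewrite [X in X * _]mulrC.
rewrite (bigD1 i)//= -[leLHS]addr0 lerD//; last first.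
  by apply: sumr_ge0 => j _; rewrite mulr_ge0.
by rewrite ler_wpM2r// -natrX ler_nat.
Qed.

Lemma aligned_block_term_ge {R : realType} {d : nat} (s : R) (theta : 'rV[R]_d)
    (i : 'I_d) (m : nat) (z : 'rV[int]_d) :
  0 <= s <= d.+2%:R -> `|theta| = `|theta 0 i| ->
  d%:R * (2 ^+ m.+1 * `|theta|) <= 1 -> aligned_block theta i m z ->
  1 / (2 ^+ m.+1) ^+ d.+2 * ((2 ^+ m * `|theta|) ^+ 2 / 8) <=
    decay s z * (1 - cos (inner (emb R z) theta)).
Proof.
move=> hs ti small zB; have zle := aligned_block_norm _ _ _ _ zB.
apply: ler_pM.
- by rewrite divr_ge0// !exprn_ge0.
- by rewrite divr_ge0// exprn_ge0.
- rewrite -(powR_mulrn d.+2)// ?exprn_ge0//.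
  exact: ler_decay (aligned_block_neq0 _ _ _ _ zB) zle.
apply: le_trans (oneB_cos_ge _ _).
  rewrite ler_pM2r// lerXn2r ?nnegrE ?mulr_ge0 ?exprn_ge0//.
    apply: le_trans (aligned_block_inner _ _ _ _ zB).
    by rewrite mulr_ge0// exprn_ge0.
  by rewrite ti; exact: aligned_block_inner zB.
apply: le_trans (inner_le _ _) (le_trans _ small).
by rewrite ler_wpM2l// ler_wpM2r.
Qed.

(** The lower bound does not depend on [m]: the [2 ^ (m * d)] points, the weight
    [2 ^ (- (m + 1) * (d + 2))] and the factor [2 ^ (2 * m)] from the cosine
    multiply to [2 ^ (- (d + 2))], and the [1/8] of the cosine bound adds [3] to
    the exponent. *)
Lemma esum_aligned_block_ge {R : realType} {d : nat} (s : R) (theta : 'rV[R]_d)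
    (i : 'I_d) (m : nat) :
  0 <= s <= d.+2%:R -> `|theta| = `|theta 0 i| ->
  d%:R * (2 ^+ m.+1 * `|theta|) <= 1 ->
  ((`|theta| ^+ 2 / 2 ^+ (d + 5))%:E <=
   \esum_(z in aligned_block theta i m)
     (decay s z * (1 - cos (inner (emb R z) theta)))%:E)%E.
Proof.
move=> hs ti small.
set c := 1 / (2 ^+ m.+1) ^+ d.+2 * ((2 ^+ m * `|theta|) ^+ 2 / 8).
apply: (@le_trans _ _ (\esum_(z in aligned_block theta i m) c%:E)%E); last first.
  by apply: le_esum => z zB; rewrite lee_fin; exact: aligned_block_term_ge zB.
rewrite esum_cube; last first.
- by rewrite /c mulr_ge0// divr_ge0// !exprn_ge0// mulr_ge0// exprn_ge0.
- exact: orient_neq0.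
have two0 k : (2 : R) ^+ k != 0 by rewrite expf_neq0.
rewrite lee_fin natrX /c le_eqVlt; apply/orP; left; apply/eqP.
have -> : 8 = 2 ^+ 3 :> R by ring.
rewrite exprMn -!exprM div1r.
have -> : (m.+1 * d.+2 = m * d + m * 2 + (d + 2))%N by lia.
rewrite !exprD; field.
by rewrite !two0.
Qed.

(** Adds up the blocks of scales [m < N], which are disjoint; the smallness
    condition on [theta] says that [<z, theta>] stays in [[-1, 1]] on them. *)
Lemma cos_sum_decay_ge {R : realType} {d : nat} (s : R) (theta : 'rV[R]_d) (N : nat) :
  d%:R < s <= d.+2%:R -> theta != 0 -> d%:R * (2 ^+ N * `|theta|) <= 1 ->
  summable [set z | z != 0]
    (EFin \o (fun z => decay s z * (1 - cos (inner (emb R z) theta)))) ->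
  N%:R * (`|theta| ^+ 2 / 2 ^+ (d + 5)) <= cos_sum (decay s) theta.
Proof.
move=> /andP[ds sd] t0 small sF; have [i ti] := norm_row_attained _ t0.
have F0 z : 0 <= decay s z * (1 - cos (inner (emb R z) theta)).
  by rewrite mulr_ge0 ?decay_ge0 ?oneB_cos_ge0.
rewrite -lee_fin EFin_usum//.
apply: (@le_trans _ _ (\esum_(z in \bigcup_m aligned_block theta i m)
     (decay s z * (1 - cos (inner (emb R z) theta)))%:E)%E); last first.
  apply: subset_esum => [z|z [m _ /aligned_block_neq0//]]; exact: F0.
rewrite nneseries_sum_bigcup//; last exact: trivIset_aligned_block.
apply: le_trans (nneseries_lim_ge N _); last first.
  by move=> m _ _; apply: esum_ge0 => z _; rewrite lee_fin.
rewrite mulr_natl -[in leLHS](subn0 N) -sumr_const_nat -sumEFin.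
rewrite big_nat [leRHS]big_nat; apply: lee_sum => m /andP[_ mN].
apply: esum_aligned_block_ge => //.
  by rewrite sd andbT (le_trans _ (ltW ds)).
apply: le_trans small; rewrite ler_wpM2l// ler_wpM2r//.
by rewrite ler_weXn2l// ler1n.
Qed.

(** * Comparison of the two sums *)

Lemma bounded_on_ball {R : realType} {d : nat} (a : 'rV[int]_d -> R) (K : nat) :
  exists2 C : R, 0 <= C & forall z, `|emb R z| < K%:R -> `|a z| <= C.
Proof.
pose pt := @cube_pt d (fun=> - K%:Z) (fun=> 1) K.*2.
exists (\sum_k `|a (pt k)|); first exact: sumr_ge0.
move=> z /ball_sub_cube[k _ <-]; rewrite (bigD1 k)//= lerDl.
exact: sumr_ge0.
Qed.

(** The difference is [(a z * |z| ^ s - 1) * decay s z]. *)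
Lemma eventually_close_decay {R : realType} {d : nat} (s : R)
    (a : 'rV[int]_d -> R) (e : R) :
  a z * `|emb R z| `^ s @[z --> lattice_infty R d] --> (1 : R) -> 0 < e ->
  exists K : nat, forall z, z != 0 -> K%:R <= `|emb R z| ->
    `|a z - decay s z| <= e * decay s z.
Proof.
move=> ha e0; have [M _ MP] := ha _ (nbhsx_ballx (1 : R) e e0).
exists (Num.truncn M).+1 => z z0 Mz.
have := MP z (lt_le_trans (truncnS_gt M) Mz) => /=.
have w0 : 0 < `|emb R z| `^ s.
  by rewrite powR_gt0// (lt_le_trans ltr01)// norm_emb_ge1.
have -> : a z - decay s z = - (1 - a z * `|emb R z| `^ s) * decay s z.
  by rewrite /decay; field; rewrite gt_eqF.
move=> /ltW h; rewrite normrM normrN [`|decay s z|]ger0_norm ?decay_ge0//.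
by rewrite ler_wpM2r ?decay_ge0.
Qed.

(** Outside a ball this is the asymptotic hypothesis; inside, [a / decay s]
    takes finitely many values. *)
Lemma decay_dominates {R : realType} {d : nat} (s : R) (a : 'rV[int]_d -> R) :
  0 <= s -> a z * `|emb R z| `^ s @[z --> lattice_infty R d] --> (1 : R) ->
  exists2 C : R, 0 <= C & forall z, z != 0 -> `|a z| <= C * decay s z.
Proof.
move=> s0 ha.
have [K KP] := eventually_close_decay s a 1 ha ltr01.
have [C C0 CP] := bounded_on_ball (fun z => a z / decay s z) K.
(* Outside the ball, [|a| <= |a - decay s| + decay s <= 2 * decay s]. *)
exists (C + 2); first by rewrite addr_ge0.
move=> z z0; have w0 := decay_gt0 s z z0.
have [/CP|/(KP z z0)] := ltP `|emb R z| K%:R.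
  rewrite normrM normfV (gtr0_norm w0) ler_pdivrMr//; nra.
have : `|a z| <= `|a z - decay s z| + `|decay s z|.
  by rewrite -{1}(subrK (decay s z) (a z)) ler_normD.
rewrite (gtr0_norm w0); nra.
Qed.

Lemma summable_le_decay {R : realType} {d : nat} (s C : R) (f : 'rV[int]_d -> R) :
  d%:R < s -> 0 <= C -> (forall z, z != 0 -> `|f z| <= C * decay s z) ->
  summable [set z | z != 0] (EFin \o f).
Proof.
move=> ds C0 fC; have sb := summable_decay s ds.
have b0 z : z != 0 -> 0 <= @decay R d s z by move=> _; exact: decay_ge0.
apply: (summable_le _ _ _ (usum_lin _ _ _ C 0 sb sb b0 b0 C0 (lexx 0)).1) => z z0 /=.
rewrite lee_fin mul0r addr0; apply: le_trans (fC z z0) (ler_norm _).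
Qed.

Lemma summable_cos_term {R : realType} {d : nat} (s C : R) (a : 'rV[int]_d -> R)
    (theta : 'rV[R]_d) :
  d%:R < s -> 0 <= C -> (forall z, z != 0 -> `|a z| <= C * decay s z) ->
  summable [set z | z != 0]
    (EFin \o (fun z => a z * (1 - cos (inner (emb R z) theta)))).
Proof.
move=> ds C0 aC; apply: (summable_le_decay s (C * 2)) => //.
  by rewrite mulr_ge0.
move=> z z0; rewrite normrM (ger0_norm (oneB_cos_ge0 _)) mulrAC.
apply: ler_pM; rewrite ?oneB_cos_ge0 ?aC//.
by have := cos_geN1 (inner (emb R z) theta); lra.
Qed.

(** Term by term: at points far from the origin the difference of the
    coefficients is at most [e * decay s z], at the others [1 - cos] is
    [O(|theta| ^ 2)] and the coefficients are [O(decay s z)].  Keeping the weight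
    in the second bound for all [z] avoids splitting the sum into two. *)
Lemma cos_sum_near {R : realType} {d : nat} (s : R) (a : 'rV[int]_d -> R) (e : R) :
  d%:R < s -> a z * `|emb R z| `^ s @[z --> lattice_infty R d] --> (1 : R) ->
  0 < e -> exists2 C : R, 0 <= C & forall theta,
    `|cos_sum a theta - cos_sum (decay s) theta| <=
      e * cos_sum (decay s) theta + C * `|theta| ^+ 2.
Proof.
move=> ds ha e0.
have s0 : 0 <= s by apply: le_trans (ltW ds).
have [A A0 aA] := decay_dominates s a s0 ha.
have [K KP] := eventually_close_decay s a e ha e0.
have b0 (z : 'rV[int]_d) : z != 0 -> 0 <= decay s z by move=> _; exact: decay_ge0.
have sb : summable [set z : 'rV[int]_d | z != 0] (EFin \o decay s).
  exact: summable_decay.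
pose B := (A + 1) * (d%:R * K%:R) ^+ 2.
have B0 : 0 <= B by rewrite mulr_ge0 ?addr_ge0 ?exprn_ge0 ?mulr_ge0.
have S0 : 0 <= usum [set z : 'rV[int]_d | z != 0] (decay s).
  by rewrite -lee_fin EFin_usum//; apply: esum_ge0 => z z0; rewrite lee_fin b0.
exists (B * usum [set z : 'rV[int]_d | z != 0] (decay s)); first exact: mulr_ge0.
move=> theta.
set g := fun z => decay s z * (1 - cos (inner (emb R z) theta)).
set f := fun z => a z * (1 - cos (inner (emb R z) theta)).
have g0 z : z != 0 -> 0 <= g z by move=> z0; rewrite mulr_ge0 ?b0 ?oneB_cos_ge0.
have sg : summable [set z | z != 0] (EFin \o g).
  apply: (summable_cos_term s 1) => // z z0.
  by rewrite mul1r ger0_norm ?b0.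
have sf : summable [set z | z != 0] (EFin \o f) by apply: (summable_cos_term s A).
have r0 : 0 <= B * `|theta| ^+ 2 by rewrite mulr_ge0// exprn_ge0.
have [sh hE] := usum_lin _ g (decay s) e (B * `|theta| ^+ 2) sg sb g0 b0 (ltW e0) r0.
have h0 z : z != 0 -> 0 <= e * g z + B * `|theta| ^+ 2 * decay s z.
  move=> z0.
  exact: addr_ge0 (mulr_ge0 (ltW e0) (g0 z z0)) (mulr_ge0 r0 (b0 z z0)).
have key z : z != 0 -> `|f z - g z| <= e * g z + B * `|theta| ^+ 2 * decay s z.
  move=> z0; have c0 := oneB_cos_ge0 (inner (emb R z) theta).
  rewrite /f /g -mulrBl normrM (ger0_norm c0).
  have [zK|/(KP z z0) near1] := ltP `|emb R z| K%:R; last first.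
    rewrite -[leLHS]addr0; apply: lerD (mulr_ge0 r0 (b0 z z0)).
    by rewrite mulrA ler_wpM2r.
  rewrite -[leLHS]add0r; apply: lerD (mulr_ge0 (ltW e0) (g0 z z0)) _.
  have cosle : 1 - cos (inner (emb R z) theta) <= (d%:R * K%:R) ^+ 2 * `|theta| ^+ 2.
    apply: le_trans (oneB_cos_le _) _.
    rewrite -(real_normK (num_real (inner _ _))).
    have : `|inner (emb R z) theta| ^+ 2 <= (d%:R * (K%:R * `|theta|)) ^+ 2.
      rewrite lerXn2r ?nnegrE ?mulr_ge0//; apply: le_trans (inner_le _ _) _.
      by rewrite ler_wpM2l// ler_wpM2r// ltW.
    rewrite mulrA exprMn; have := exprn_ge0 2 (normr_ge0 (inner (emb R z) theta)).
    lra.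
  have able : `|a z - decay s z| <= (A + 1) * decay s z.
    apply: le_trans (ler_normB _ _) _.
    by rewrite (ger0_norm (b0 z z0)) mulrDl mul1r lerD2r aA.
  have -> : B * `|theta| ^+ 2 * decay s z =
      (A + 1) * decay s z * ((d%:R * K%:R) ^+ 2 * `|theta| ^+ 2) by rewrite /B; ring.
  exact: ler_pM.
have fg : usum [set z | z != 0] f <= usum [set z | z != 0] g +
    usum [set z | z != 0] (fun z => e * g z + B * `|theta| ^+ 2 * decay s z).
  apply: usum_le_add => // z z0; have := key z z0.
  by rewrite ler_norml => /andP[_]; rewrite lerBlDl.
have gf : usum [set z | z != 0] g <= usum [set z | z != 0] f +
    usum [set z | z != 0] (fun z => e * g z + B * `|theta| ^+ 2 * decay s z).
  apply: usum_le_add => // z z0; have := key z z0.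
  by rewrite distrC ler_norml => /andP[_]; rewrite lerBlDl.
rewrite /cos_sum -/f -/g; move: fg gf; rewrite hE.
by rewrite ler_norml => fg gf; apply/andP; split; lra.
Qed.

(** Take [N] scales with [N >= K * 2 ^ (d + 5)], and [theta] small enough for
    all of them. *)
Lemma cos_sum_decay_dominates_sqr {R : realType} {d : nat} (s K : R) :
  d%:R < s <= d.+2%:R ->
  exists2 delta : R, 0 < delta & forall theta : 'rV[R]_d, theta != 0 ->
    `|theta| < delta -> K * `|theta| ^+ 2 <= cos_sum (decay s) theta.
Proof.
move=> /andP[ds sd]; pose N := (Num.truncn (K * 2 ^+ (d + 5))).+1.
have D0 : 0 < d.+1%:R * 2 ^+ N :> R by rewrite mulr_gt0// exprn_gt0.
(* [d.+1] rather than [d] keeps the radius positive for every [d]. *)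
exists (d.+1%:R * 2 ^+ N)^-1; first by rewrite invr_gt0.
move=> theta t0 small.
have F := cos_sum_decay_ge s theta N.
apply: le_trans (F _ t0 _ _).
- rewrite [leRHS]mulrCA [leLHS]mulrC; apply: ler_wpM2l; first exact: exprn_ge0.
  by rewrite ler_pdivlMr ?exprn_gt0//; apply/ltW/truncnS_gt.
- by rewrite ds sd.
- move: small; rewrite -[_^-1]mul1r ltr_pdivlMr// => /ltW; apply: le_trans.
  by rewrite [leRHS]mulrC -mulrA ler_wpM2r ?ler_nat//.
- apply: (summable_cos_term s 1) => // z z0.
  by rewrite mul1r ger0_norm ?decay_ge0.
Qed.

Theorem theorem4 (R : realType) (d : nat) (alpha : R) (a : 'rV[int]_d -> R)
    (hd : (1 <= d)%N) (halpha0 : 0 < alpha) (halpha2 : alpha <= 2)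
    (ha : a z * `|emb R z| `^ (d%:R + alpha) @[z --> lattice_infty R d]
            --> (1 : R)) :
  let F := cos_sum a in
  let Fd := cos_sum (fun z => 1 / `|emb R z| `^ (d%:R + alpha)) in
  asymp_equiv F Fd (0 : 'rV[R]_d).
Proof.
move=> F Fd; set s := d%:R + alpha.
have sd : d%:R < s <= d.+2%:R.
  by rewrite ltrDl halpha0/= -addn2 natrD lerD2l.
have /andP[ds _] := sd.
apply/cvgrPdist_le => e e0.
have e20 : 0 < e / 2 by rewrite divr_gt0.
have [C C0 near_F] := cos_sum_near s a (e / 2) ds ha e20.
(* This constant makes [C * |theta| ^ 2] at most [e / 2 * Fd theta], and the
   [+ 1] makes [Fd theta] positive even if [C = 0]. *)
have [delta delta0 Fd_ge] := @cos_sum_decay_dominates_sqr R d s (C / (e / 2) + 1) sd.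
near=> theta.
have t0 : theta != 0 by near: theta; exact: nbhs_dnbhs_neq.
have tdelta : `|theta| < delta by near: theta; exact: dnbhs0_lt.
have := Fd_ge theta t0 tdelta; have := near_F theta.
rewrite -/F -[cos_sum (decay s)]/Fd => FFd FdK.
have tt : 0 < `|theta| ^+ 2 by rewrite exprn_gt0// normr_gt0.
have CK : C * `|theta| ^+ 2 <= e / 2 * Fd theta.
  apply: le_trans (ler_wpM2l (ltW e20) FdK).
  have -> : e / 2 * ((C / (e / 2) + 1) * `|theta| ^+ 2) =
    C * `|theta| ^+ 2 + e / 2 * `|theta| ^+ 2 by field; rewrite gt_eqF.
  by rewrite lerDl mulr_ge0// ltW.
have Fd0 : 0 < Fd theta.
  by apply: lt_le_trans FdK; rewrite mulr_gt0// ltr_wpDl// divr_ge0// (ltW e20).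
have -> : 1 - F theta / Fd theta = - (F theta - Fd theta) / Fd theta.
  by field; rewrite gt_eqF.
rewrite normrM normrN normfV (gtr0_norm Fd0) ler_pdivrMr//.
by apply: le_trans FFd _; lra.
Unshelve. all: by end_near.
Qed.
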